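(* Let $(L,\leq,\wedge,\vee,0,1)$ be a complete lattice with bottom element $0$ and top element $1$, let $\{[a_i,b_i]\}_{i\in\mathbb{Z}}$ be a family of subintervals of $L$ (with $a_i\le b_i$) such that $b_i\leq a_{i+1}$ for all $i\in\mathbb{Z}$, let $a=\bigwedge_{i\in\mathbb{Z}}a_i$, and for each $i\in\mathbb{Z}$ let $T_i$ be a t-norm on $[a_i,b_i]$. Set $$A_1'=\{x\in L\mid(\exists i\in\mathbb{Z})(x\in I_{a_i})\ \text{and}\ \inf\{i\in\mathbb{Z}\mid x\in I_{a_i}\}=-\infty\},\qquad \Lambda_1=\left(A_1'\times[0,1[\,\right)\cup\left([0,1[\,\times A_1'\right),$$ and, for $i\in\mathbb{Z}$, $$\Lambda_2^i=\Big(\left(\,]b_{i-1},1[\,\cap I_{a_i}\right)\times[b_{i-1},1[\,\Big)\cup\Big([b_{i-1},1[\,\times\left(\,]b_{i-1},1[\,\cap I_{a_i}\right)\Big),$$ $$\Lambda_3^i=\Big(\left(\,]a_i,1[\,\cap I_{b_i}\right)\times[a_i,1[\,\Big)\cup\Big([a_i,1[\,\times\left(\,]a_i,1[\,\cap I_{b_i}\right)\Big).$$ Then the binary operation (ordinal sum) $T=\{\langle a_i,b_i,T_i\rangle\}_{i\in\mathbb{Z}}\colon L\times L\to L$ given by $$T(x,y)=\begin{cases}T_i(x,y)&\text{if }(x,y)\in[a_i,b_i]^2\text{ for some }i\in\mathbb{Z},\\ T_i(x\wedge b_i,\,y\wedge b_i)&\text{if }(x,y)\in\Lambda_3^i\text{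 for some }i\in\mathbb{Z},\\ x\wedge y\wedge a_i&\text{if }(x,y)\in\Lambda_2^i\text{ for some }i\in\mathbb{Z},\\ x\wedge y\wedge a&\text{if }(x,y)\in\Lambda_1,\\ x\wedge y&\text{otherwise,}\end{cases}$$ is a t-norm on $L$.
   Context: For $a\leq b$ in a lattice $L$, $[a,b]=\{x\in L\mid a\leq x\leq b\}$; similarly $[a,b[\,=\{x\in L\mid a\leq x<b\}$ and $]a,b[\,=\{x\in L\mid a<x<b\}$, where $x<y$ means $x\leq y$ and $x\neq y$. For $a\in L$, $I_a$ denotes the set of all elements of $L$ incomparable with $a$, i.e. $x\in I_a$ iff neither $x\leq a$ nor $a\leq x$. A t-norm on a subinterval $[a,b]$ of $L$ is a binary operation $T\colon[a,b]\times[a,b]\to[a,b]$ such that for all $x,y,z\in[a,b]$: $T(x,y)=T(y,x)$; $x\leq y$ implies $T(x,z)\leq T(y,z)$; $T(T(x,y),z)=T(x,T(y,z))$; and $T(b,x)=x$. A t-norm on $L$ is a t-norm on $[0,1]=L$. *)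

(* Defs.v *)
From mathcomp Require Import all_boot all_order all_algebra.
From mathcomp Require Import boolp classical_sets.

Set Implicit Arguments.
Unset Strict Implicit.
Unset Printing Implicit Defensive.

Import Order.TTheory.
Local Open Scope order_scope.
Local Open Scope classical_set_scope.

Definition complete_lattice (d : Order.disp_t) (L : latticeType d) : Prop :=
  forall S : set L, supremums S !=set0 /\ infimums S !=set0.

Section Intervals.
Context {d : Order.disp_t} {L : porderType d}.
Implicit Types a b x : L.

Definition itvcc a b : set L := [set x | a <= x <= b].
Definition itvco a b : set L := [set x | a <= x < b].
Definition itvoo a b : set L := [set x | a < x < b].
Definition incomp a : set L := [set x | x >< a].

(* A binary operation on [a, b] is represented by a total function on L; only
   its values on [a, b] x [a, b] are constrained. *)
Definition is_tnorm_on a b (T : L -> L -> L) : Prop :=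
  [/\ forall x y, itvcc a b x -> itvcc a b y -> itvcc a b (T x y),
      forall x y, itvcc a b x -> itvcc a b y -> T x y = T y x,
      forall x y z, itvcc a b x -> itvcc a b y -> itvcc a b z ->
        x <= y -> T x z <= T y z,
      forall x y z, itvcc a b x -> itvcc a b y -> itvcc a b z ->
        T (T x y) z = T x (T y z)
    & forall x, itvcc a b x -> T b x = x].

End Intervals.

Definition is_tnorm (d : Order.disp_t) (L : tbLatticeType d)
  (T : L -> L -> L) : Prop := is_tnorm_on \bot \top T.

Section OrdinalSum.
Context {d : Order.disp_t} {L : tbLatticeType d}.
Variables (a b : int -> L) (Ti : int -> L -> L -> L).
Implicit Types (i : int) (x y : L).

(* For a nonempty set of integers, having infimum -oo means being unbounded
   below. *)
Definition A1' : set L :=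
  [set x | (exists i, incomp (a i) x) /\
           ~ has_lbound [set i : int | incomp (a i) x]].

Definition Lambda1 : set (L * L) :=
  (A1' `*` itvco \bot \top) `|` (itvco \bot \top `*` A1').

Definition Lambda2 i : set (L * L) :=
  let b' := b (i - 1)%R in
  ((itvoo b' \top `&` incomp (a i)) `*` itvco b' \top) `|`
  (itvco b' \top `*` (itvoo b' \top `&` incomp (a i))).

Definition Lambda3 i : set (L * L) :=
  ((itvoo (a i) \top `&` incomp (b i)) `*` itvco (a i) \top) `|`
  (itvco (a i) \top `*` (itvoo (a i) \top `&` incomp (b i))).

Definition square i : set (L * L) := itvcc (a i) (b i) `*` itvcc (a i) (b i).

(* T is given by the case distinction defining the ordinal sum.  The clauses are
   not prioritised: wherever several apply, all of them are required to hold, so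
   the existence of such a T includes the consistency of the cases. *)
Definition is_ordinal_sum (T : L -> L -> L) : Prop :=
  let a_inf := infimum \bot (range a) in
  [/\ forall i x y, square i (x, y) -> T x y = Ti i x y,
      forall i x y, Lambda3 i (x, y) ->
        T x y = Ti i (x `&` b i)%O (y `&` b i)%O,
      forall i x y, Lambda2 i (x, y) -> T x y = (x `&` y `&` a i)%O,
      forall x y, Lambda1 (x, y) -> T x y = (x `&` y `&` a_inf)%O
    & forall x y,
        ~ (exists i, square i (x, y)) -> ~ (exists i, Lambda3 i (x, y)) ->
        ~ (exists i, Lambda2 i (x, y)) -> ~ Lambda1 (x, y) ->
        T x y = (x `&` y)%O].

End OrdinalSum.

(* Main.v *)
Require Import Defs.
From mathcomp Require Import all_boot all_order all_algebra.
From mathcomp Require Import boolp classical_sets.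
From mathcomp Require Import zify.

(** Let C be the set of the elements of L that are comparable with every
    endpoint a_i, b_i.  Everything difficult about the ordinal sum disappears on
    C: an element of C lies below a_i, in [a_i, b_i], or above b_i, so the usual
    argument for ordinal sums on a chain shows that the operation S equal to T_i
    on [a_i, b_i]^2 and to the meet elsewhere is associative and monotone there.
    The main tool is that S (x, y) = x as soon as an endpoint separates x from y
    ([chain_sum_sep]); the t-norm properties of S are [chain_sum_mono] and
    [chain_sum_assoc].

    The set C is closed under arbitrary suprema ([comparables_sup]), so every x
    has a largest element p x of C below it, and p is an interior operator.
    Associativity and monotonicity transfer from S to the operation
      T (x, y) = S (p x, p y) for x, y <> 1,   T (1, x) = T (x, 1) = x,
    because p is monotone and fixes the values of S ([interior_ext_tnorm]).

    It remains to see that this T is the operation given by the case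
    distinction.  An element x <> 1 outside C falls into one of three
    classes, according to where it leaves the chain of endpoints
    ([not_comparables_cases]): no a_i is below x, and then p x = x /\ a, with a
    the infimum of all a_i; or b_{i-1} < x with x incomparable to a_i, and then
    p x = x /\ a_i; or a_i < x with x incomparable to b_i, and then
    p x = x /\ b_i.  These are the sets that occur in Lambda_1, Lambda_2^i and
    Lambda_3^i, and substituting these values of p into S (p x, p y) yields the
    prescribed formulas.  Since one operation satisfies all clauses, the clauses
    are consistent where they overlap; they cover L x L, so it is unique. *)

Set Implicit Arguments.
Unset Strict Implicit.
Unset Printing Implicit Defensive.

Import Order.TTheory.
Local Open Scope classical_set_scope.
Local Open Scope order_scope.

(** * Suprema and interior operators in a complete lattice *)

Section Interior.
Context {d : Order.disp_t} {L : tbLatticeType d}.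
Implicit Types (A C K : set L) (x y z c : L).

(** On the empty set, [supremum] is its default value; taking the bottom element
    as default makes it a genuine supremum in that case too. *)
Lemma supremumsP A :
  complete_lattice L -> supremums A (supremum \bot A).
Proof.
move=> Lc; rewrite /supremum; case: ifPn => [/eqP ->|_].
  by split=> [x []|x _]; exact: le0x.
by apply: xgetPex; case: (Lc A).
Qed.

Lemma infimumsP x0 A :
  complete_lattice L -> A !=set0 -> infimums A (infimum x0 A).
Proof.
move=> Lc /set0P A0; rewrite /infimum (negbTE A0).
by apply: xgetPex; case: (Lc A).
Qed.

Definition interior C x : L := supremum \bot [set z | C z /\ z <= x].

Definition is_interior C (p : L -> L) : Prop :=
  forall x, [/\ C (p x), p x <= x & forall z, C z -> z <= x -> z <= p x].

Lemma interiorP C : complete_lattice L ->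
  (forall A z, A `<=` C -> supremums A z -> C z) -> is_interior C (interior C).
Proof.
move=> Lc Csup x; have sup_p := supremumsP [set z | C z /\ z <= x] Lc.
split; first by apply: Csup sup_p => z [].
- by apply: (proj2 sup_p) => z [].
- by move=> z Cz zx; apply: (proj1 sup_p).
Qed.

(** The top element is treated apart since T (1, x) must be x itself, whereas
    S (p 1, p x) is at most p x for the operations S considered here. *)
Definition interior_ext (p : L -> L) (S : L -> L -> L) x y : L :=
  if x == \top then y else if y == \top then x else S (p x) (p y).

Lemma interior_ext_neq1 p S x y :
  x != \top -> y != \top -> interior_ext p S x y = S (p x) (p y).
Proof. by rewrite /interior_ext => /negbTE -> /negbTE ->. Qed.

Lemma interior_ext_comm p S x y : (forall u v, S u v = S v u) ->
  interior_ext p S x y = interior_ext p S y x.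
Proof.
move=> Scomm; rewrite /interior_ext Scomm.
by case: (x =P \top) => [->|_]; case: (y =P \top).
Qed.

Section InteriorTheory.
Variables (C : set L) (p : L -> L).
Hypothesis p_int : is_interior C p.

Lemma interior_in x : C (p x). Proof. by case: (p_int x). Qed.

Lemma interior_le x : p x <= x. Proof. by case: (p_int x). Qed.

Lemma interior_max z x : C z -> z <= x -> z <= p x.
Proof. by case: (p_int x) => _ _; apply. Qed.

Lemma interior_id x : C x -> p x = x.
Proof.
by move=> Cx; apply/le_anti; rewrite interior_le interior_max.
Qed.

Lemma interior_mono x y : x <= y -> p x <= p y.
Proof.
by move=> xy; apply: interior_max (interior_in x) (le_trans (interior_le x) xy).
Qed.

(** Below c, the interior of x loses nothing if the meet of x and c is in C. *)
Lemma interior_meet x c : C (x `&` c) -> p x `&` c = x `&` c.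
Proof.
move=> Cxc; apply/le_anti; rewrite leI2 ?interior_le //=.
by rewrite lexI leIr andbT interior_max ?leIl.
Qed.

(** Monotonicity comes from that of p.  For associativity, S (p x, p y) is in C,
    hence fixed by p, so that both sides reduce to S applied three times at p x,
    p y, p z. *)
Lemma interior_ext_tnorm (S : L -> L -> L) :
  (forall x y, C x -> C y -> C (S x y)) ->
  (forall x y, S x y = S y x) ->
  (forall x y, S x y <= x) ->
  (forall x y z, C x -> C y -> C z -> x <= y -> S x z <= S y z) ->
  (forall x y z, C x -> C y -> C z -> S (S x y) z = S x (S y z)) ->
  is_tnorm (interior_ext p S).
Proof.
move=> SC Scomm Sle Smono Sassoc; have pC := interior_in.
(* A value of S never brings the exceptional case of the top element back. *)
have S_lt x y : x != \top -> S (p x) (p y) != \top.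
  apply: contra_neq => Stop; apply/le_anti; rewrite lex1 /= -Stop.
  by rewrite (le_trans (Sle _ _)) ?interior_le.
split=> [x y _ _|x y _ _|x y z _ _ _ xy|x y z _ _ _|x _].
- by rewrite /itvcc /= le0x lex1.
- exact: interior_ext_comm.
- rewrite /interior_ext; case: (eqVneq y \top) => [_|yt].
    case: eqP => // _; case: eqP => [->|_]; first exact: lex1.
    by rewrite Scomm (le_trans (Sle _ _)) ?interior_le.
  have xt : x != \top.
    by apply: contra_neq yt => xt; apply/le_anti; rewrite lex1 -xt.
  rewrite (negbTE xt); case: eqP => // _.
  exact: Smono (pC _) (pC _) (pC _) (interior_mono xy).
- rewrite /interior_ext; case: (eqVneq x \top) => [//|xt].
  case: (eqVneq y \top) => [|yt]; first by rewrite (negbTE xt).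
  rewrite (negbTE (S_lt _ _ xt)).
  case: (eqVneq z \top) => [|zt]; first by rewrite (negbTE yt).
  rewrite (negbTE (S_lt _ _ yt)).
  rewrite (interior_id (SC _ _ (pC x) (pC y))).
  by rewrite (interior_id (SC _ _ (pC y) (pC z))) Sassoc.
- by rewrite /interior_ext eqxx.
Qed.

End InteriorTheory.

Definition comparables K : set L := [set z | forall c, K c -> z >=< c].

(** If some x in A is above c, so is the supremum; otherwise c is an upper bound
    of A, hence above the supremum.  This provides the interior operator. *)
Lemma comparables_sup K A z :
  A `<=` comparables K -> supremums A z -> comparables K z.
Proof.
move=> AK [zub zlub] c Kc.
case: (pselect (exists2 x, A x & c <= x)) => [[x Ax cx]|Nc].
  by apply/orP; right; apply: le_trans cx (zub _ Ax).
apply/orP; left; apply: zlub => x Ax; case/orP: (AK _ Ax _ Kc) => // cx.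
by case: Nc; exists x.
Qed.

Lemma comparables_meet K x y :
  comparables K x -> comparables K y -> comparables K (x `&` y).
Proof.
move=> Kx Ky c Kc; rewrite /Order.comparable lexI.
case/orP: (Kx _ Kc) => [xc|->]; first by rewrite (le_trans (leIl _ _) xc).
by case/orP: (Ky _ Kc) => [yc|->]; rewrite ?orbT // (le_trans (leIr _ _) yc).
Qed.

End Interior.

(** * The chain of endpoints *)

Section Chain.
Context {d : Order.disp_t} {L : tbLatticeType d}.
Variables (a b : int -> L).
Hypothesis le_ab : forall i : int, a i <= b i.
Hypothesis le_ba : forall i : int, b i <= a (i + 1)%R.
Implicit Types (i j k : int) (x y z c : L).

Lemma le_a i j : (i <= j)%R -> a i <= a j.
Proof.
move=> ij; have -> : j = (i + `|j - i|%N%:Z)%R by lia.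
elim: `|j - i|%N => [|n IHn]; first by rewrite GRing.addr0.
apply: le_trans IHn (le_trans (le_ab _) _).
by have := le_ba (i + n%:Z)%R; rewrite -GRing.addrA -PoszD addn1.
Qed.

Lemma le_b_a i j : (i < j)%R -> b i <= a j.
Proof. by move=> ij; apply: le_trans (le_ba i) (le_a _); lia. Qed.

Lemma le_b i j : (i <= j)%R -> b i <= b j.
Proof.
rewrite le_eqVlt => /orP[/eqP -> //|ij].
exact: le_trans (le_b_a ij) (le_ab j).
Qed.

Lemma le_bpred i : b (i - 1)%R <= a i.
Proof. by apply: le_b_a; lia. Qed.

Definition endpoint : set L := [set c | exists i, c = a i \/ c = b i].

Lemma endpoint_a i : endpoint (a i). Proof. by exists i; left. Qed.
Lemma endpoint_b i : endpoint (b i). Proof. by exists i; right. Qed.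

(** No endpoint lies strictly inside an interval [a_j, b_j]. *)
Lemma endpoint_outside c j : endpoint c -> c <= a j \/ b j <= c.
Proof.
move=> [i [->|->]].
  by case: (ltP j i) => ij; [right; apply: le_b_a|left; apply: le_a].
by case: (ltP i j) => ij; [left; apply: le_b_a|right; apply: le_b].
Qed.

(** No endpoint lies strictly between b_{j-1} and a_j. *)
Lemma endpoint_outside_gap c j : endpoint c -> c <= b (j - 1)%R \/ a j <= c.
Proof.
move=> [i [->|->]]; case: (ltP i j) => ij.
- by left; apply: le_trans (le_ab i) (le_b _); lia.
- by right; apply: le_a.
- by left; apply: le_b; lia.
- by right; apply: le_trans (le_a ij) (le_ab i).
Qed.

Lemma endpoint_total c c' : endpoint c -> endpoint c' -> c <= c' \/ c' <= c.
Proof.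
move=> Ec [j [->|->]]; case: (endpoint_outside j Ec) => H; auto.
- by right; apply: le_trans (le_ab j) H.
- by left; apply: le_trans H (le_ab j).
Qed.

Local Notation C := (comparables endpoint).

Lemma endpoint_comparables c : endpoint c -> C c.
Proof.
move=> Ec c' Ec'; apply/orP.
by case: (endpoint_total Ec Ec') => ->; [left|right].
Qed.

Lemma itv_comparables i x : itvcc (a i) (b i) x -> C x.
Proof.
move=> /andP[ax xb] c Ec; apply/orP.
case: (endpoint_outside i Ec) => H; [right|left].
- exact: le_trans H ax.
- exact: le_trans xb H.
Qed.

Lemma gap_comparables i x : itvcc (b (i - 1)%R) (a i) x -> C x.
Proof.
move=> /andP[bx xa] c Ec; apply/orP.
case: (endpoint_outside_gap i Ec) => H; [right|left].
- exact: le_trans H bx.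
- exact: le_trans xa H.
Qed.

Lemma below_comparables x : (forall i, x <= a i) -> C x.
Proof.
move=> xa c [i [->|->]]; apply/orP; left=> //.
exact: le_trans (xa i) (le_ab i).
Qed.

Lemma comparables_cases x i :
  C x -> [\/ x <= a i, itvcc (a i) (b i) x | b i <= x].
Proof.
move=> Cx; case/orP: (Cx _ (endpoint_a i)) => [|ax]; first by constructor 1.
case/orP: (Cx _ (endpoint_b i)) => [xb|]; last by constructor 3.
by constructor 2; apply/andP.
Qed.

(** * The ordinal sum on the elements comparable with every endpoint *)

Variable Ti : int -> L -> L -> L.
Hypothesis Ti_tnorm : forall i, is_tnorm_on (a i) (b i) (Ti i).

Local Notation I i := (itvcc (a i) (b i)).

Lemma a_in i : I i (a i). Proof. by rewrite /itvcc /= lexx le_ab. Qed.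
Lemma b_in i : I i (b i). Proof. by rewrite /itvcc /= lexx le_ab. Qed.

#[local] Hint Resolve a_in b_in : core.

Lemma Ti_in i x y : I i x -> I i y -> I i (Ti i x y).
Proof. by case: (Ti_tnorm i) => + _ _ _ _; apply. Qed.

Lemma Ti_comm i x y : I i x -> I i y -> Ti i x y = Ti i y x.
Proof. by case: (Ti_tnorm i) => _ + _ _ _; apply. Qed.

Lemma Ti_mono i x y z :
  I i x -> I i y -> I i z -> x <= y -> Ti i x z <= Ti i y z.
Proof. by case: (Ti_tnorm i) => _ _ + _ _; apply. Qed.

Lemma Ti_assoc i x y z :
  I i x -> I i y -> I i z -> Ti i (Ti i x y) z = Ti i x (Ti i y z).
Proof. by case: (Ti_tnorm i) => _ _ _ + _; apply. Qed.

Lemma Ti_b i x : I i x -> Ti i (b i) x = x.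
Proof. by case: (Ti_tnorm i) => _ _ _ _; apply. Qed.

Lemma Ti_ler i x y : I i x -> I i y -> Ti i x y <= y.
Proof.
move=> Ix Iy; rewrite -[leRHS](Ti_b Iy) Ti_mono //.
by case/andP: Ix.
Qed.

Lemma Ti_lel i x y : I i x -> I i y -> Ti i x y <= x.
Proof. by move=> Ix Iy; rewrite Ti_comm // Ti_ler. Qed.

(** Monotonicity and neutrality of b_i make a_i an annihilator of T_i. *)
Lemma Ti_a i x : I i x -> Ti i (a i) x = a i.
Proof.
move=> Ix; apply/le_anti; rewrite Ti_lel //=.
by case/andP: (Ti_in (a_in i) Ix).
Qed.

(** The index is chosen arbitrarily among those whose square contains (x, y);
    the choice is immaterial by [Ti_agree]. *)
Definition chain_sum x y : L :=
  if pselect (exists i, square a b i (x, y)) is left h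
  then Ti (projT1 (cid h)) x y else x `&` y.

Local Notation S := chain_sum.

(** Two intervals of the family can only share a common endpoint. *)
Lemma itv_overlap i j x : (i < j)%R -> I i x -> I j x -> x = b i /\ x = a j.
Proof.
move=> ij /andP[_ xb] /andP[ax _]; have ba := le_b_a ij.
by split; apply/le_anti; apply/andP; split=> //;
  [apply: le_trans ba ax | apply: le_trans xb ba].
Qed.

(** Both arguments are then the shared endpoint, which is idempotent for T_i as
    the neutral element and for T_j as the annihilator (i < j). *)
Lemma Ti_agree i j x y :
  I i x -> I i y -> I j x -> I j y -> Ti i x y = Ti j x y.
Proof.
wlog ij : i j / (i < j)%R => [W Iix Iiy Ijx Ijy|].
  case: (ltgtP i j) => [ij|ij|-> //]; first exact: W.
  by apply/esym; apply: W.
move=> Iix Iiy Ijx Ijy.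
have [xb xa] := itv_overlap ij Iix Ijx.
have [yb ya] := itv_overlap ij Iiy Ijy.
by rewrite {1}xb Ti_b // xa Ti_a.
Qed.

Lemma chain_sumE i x y : I i x -> I i y -> S x y = Ti i x y.
Proof.
move=> Ix Iy; rewrite /chain_sum; case: pselect => [h|[]]; last by exists i.
by case: (cid h) => j [/= Jx Jy]; apply: Ti_agree.
Qed.

Lemma chain_sum_meet x y :
  (forall i, I i x -> I i y -> False) -> S x y = x `&` y.
Proof.
move=> N; rewrite /chain_sum; case: pselect => // - [i [/= Ix Iy]].
by case: (N i).
Qed.

Lemma chain_sum_cases x y :
  (exists i, I i x /\ I i y) \/ (forall i, I i x -> I i y -> False).
Proof.
by case: (pselect (exists i, I i x /\ I i y)) => [|N]; [left|right=> i Ix Iy];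
  last by apply: N; exists i.
Qed.

Lemma chain_sum_comm x y : S x y = S y x.
Proof.
case: (chain_sum_cases x y) => [[i [Ix Iy]]|N].
  by rewrite !(@chain_sumE i) // Ti_comm.
by rewrite !chain_sum_meet 1?meetC // => i Iy Ix; apply: N Ix Iy.
Qed.

Lemma chain_sum_le x y : S x y <= x.
Proof.
case: (chain_sum_cases x y) => [[i [Ix Iy]]|N].
  by rewrite (@chain_sumE i) // Ti_lel.
by rewrite chain_sum_meet // leIl.
Qed.

Lemma chain_sum_in x y : C x -> C y -> C (S x y).
Proof.
move=> Cx Cy; case: (chain_sum_cases x y) => [[i [Ix Iy]]|N].
  by rewrite (@chain_sumE i) //; apply: itv_comparables (Ti_in Ix Iy).
by rewrite chain_sum_meet //; apply: comparables_meet.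
Qed.

(** If x and y are in a common interval, the separating endpoint cannot be
    strictly inside it, so x is the annihilator or y is the neutral element.
    Most case analyses on [chain_sum] end here. *)
Lemma chain_sum_sep c x y : endpoint c -> x <= c -> c <= y -> S x y = x.
Proof.
move=> Ec xc cy; have xy := le_trans xc cy.
case: (chain_sum_cases x y) => [[j [Ix Iy]]|N]; last first.
  by rewrite chain_sum_meet //; apply/meet_idPl.
rewrite (chain_sumE Ix Iy).
case/andP: (Ix) => ax xb; case/andP: (Iy) => ay yb.
case: (endpoint_outside j Ec) => H.
  have -> : x = a j by apply/le_anti; rewrite ax (le_trans xc).
  exact: Ti_a.
have -> : y = b j by apply/le_anti; rewrite yb (le_trans H).
by rewrite Ti_comm // Ti_b.
Qed.

Lemma chain_sum_sepr c x y : endpoint c -> y <= c -> c <= x -> S x y = y.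
Proof. by move=> *; rewrite chain_sum_comm (@chain_sum_sep c). Qed.

(** Two elements of the gap between b_{i-1} and a_i can share a square only in
    borderline cases, such as both being equal to b_{i-1}; an endpoint then
    separates them and the value is the meet all the same. *)
Lemma chain_sum_gap i x y : itvcc (b (i - 1)%R) (a i) x ->
  itvcc (b (i - 1)%R) (a i) y -> S x y = x `&` y.
Proof.
move=> /andP[bx xa] /andP[bY ya].
case: (chain_sum_cases x y) => [[j [/andP[ax xb] /andP[ay yb]]]|N]; last first.
  exact: chain_sum_meet.
case: (ltP j i) => ij.
  have cy : b j <= y by apply: le_trans bY; apply: le_b; lia.
  rewrite (chain_sum_sep (endpoint_b j)) //.
  by apply/esym/meet_idPl/(le_trans xb cy).
have xc := le_trans xa (le_a ij).
rewrite (chain_sum_sep (endpoint_a j)) //.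
by apply/esym/meet_idPl/(le_trans xc ay).
Qed.

(** When only y and z share a square, x is below that interval and a_i separates
    x from z.  When y and z share none, the bound is the meet of y and z, and
    S is below the meet. *)
Lemma chain_sum_mono x y z : C x -> C y -> C z -> x <= y -> S x z <= S y z.
Proof.
move=> Cx Cy Cz xy; case: (chain_sum_cases y z) => [[i [Iy Iz]]|Nyz].
  case: (comparables_cases i Cx) => [xa|Ix|bx].
  - rewrite (chain_sumE Iy Iz) (@chain_sum_sep (a i)) //.
    + by apply: le_trans xa _; case/andP: (Ti_in Iy Iz).
    + exact: endpoint_a.
    + by case/andP: Iz.
  - by rewrite !(@chain_sumE i) // Ti_mono.
  - suff -> : x = y by [].
    by apply/le_anti; rewrite xy (le_trans _ bx) //; case/andP: Iy.
rewrite (chain_sum_meet Nyz) lexI chain_sum_comm chain_sum_le andbT.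
by rewrite chain_sum_comm (le_trans (chain_sum_le _ _)).
Qed.

(** If z is outside [a_i, b_i], it is separated from x, y and S (x, y) by a_i or
    by b_i, so each S with z as an argument returns the smaller one. *)
Lemma chain_sum_assoc_l i x y z : I i x -> I i y -> C z ->
  S (S x y) z = S x (S y z).
Proof.
move=> Ix Iy Cz; have ISxy := Ti_in Ix Iy; have SE := chain_sumE Ix Iy.
case: (comparables_cases i Cz) => [za|Iz|bz].
- have E w : I i w -> S w z = z.
    by case/andP=> aw _; rewrite (@chain_sum_sepr (a i)) //; exact: endpoint_a.
  by rewrite !E // SE.
- by rewrite SE (chain_sumE ISxy Iz) (chain_sumE Iy Iz)
    (chain_sumE Ix (Ti_in Iy Iz)) Ti_assoc.
- have E w : I i w -> S w z = w.
    by case/andP=> _ wb; rewrite (@chain_sum_sep (b i)) //; exact: endpoint_b.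
  by rewrite !E // SE.
Qed.

Lemma chain_sum_assoc_m i x y z : I i x -> I i z -> C y ->
  S (S x y) z = S x (S y z).
Proof.
move=> Ix Iz Cy; case: (comparables_cases i Cy) => [ya|Iy|bz].
- have E w : I i w -> S w y = y.
    by case/andP=> aw _; rewrite (@chain_sum_sepr (a i)) //; exact: endpoint_a.
  by rewrite (chain_sum_comm y z) !E // chain_sum_comm E.
- exact: chain_sum_assoc_l Ix Iy (itv_comparables Iz).
- have E w : I i w -> S w y = w.
    by case/andP=> _ wb; rewrite (@chain_sum_sep (b i)) //; exact: endpoint_b.
  by rewrite (chain_sum_comm y z) !E.
Qed.

(** The meet of x and y may enter the interval of z although x and y do not, but
    only at its upper end b_i, which is neutral. *)
Lemma chain_sum_meet3 x y z : C x -> C y ->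
  (forall i, I i x -> I i z -> False) -> (forall i, I i y -> I i z -> False) ->
  S (x `&` y) z = x `&` y `&` z.
Proof.
move=> Cx Cy Nxz Nyz.
case: (chain_sum_cases (x `&` y) z) => [[i [Ixy Iz]]|];
  last exact: chain_sum_meet.
case/andP: (Ixy); rewrite lexI => /andP[ax ay] xyb.
have bw w : C w -> a i <= w -> (I i w -> I i z -> False) -> b i <= w.
  move=> Cw aw Nwz; case: (comparables_cases i Cw) => // [wa|Iw].
    by case: Nwz => //; rewrite /itvcc /= aw (le_trans wa).
  by case: Nwz.
have -> : x `&` y = b i.
  apply/le_anti; rewrite xyb lexI.
  by rewrite (bw _ Cx ax (@Nxz i)) (bw _ Cy ay (@Nyz i)).
case/andP: Iz => _ zb; rewrite (@chain_sum_sepr (b i)) //.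
  by apply/esym/meet_idPr.
exact: endpoint_b.
Qed.

Lemma chain_sum_assoc x y z : C x -> C y -> C z -> S (S x y) z = S x (S y z).
Proof.
move=> Cx Cy Cz.
case: (chain_sum_cases x y) => [[i [Ix Iy]]|Nxy].
  exact: chain_sum_assoc_l Ix Iy Cz.
case: (chain_sum_cases y z) => [[i [Iy Iz]]|Nyz].
  rewrite [LHS]chain_sum_comm [S x y]chain_sum_comm.
  rewrite -(chain_sum_assoc_l Iz Iy Cx).
  by rewrite chain_sum_comm (chain_sum_comm z).
case: (chain_sum_cases x z) => [[i [Ix Iz]]|Nxz].
  exact: chain_sum_assoc_m Ix Iz Cy.
rewrite (chain_sum_meet Nxy) (chain_sum_meet Nyz) chain_sum_meet3 //.
rewrite chain_sum_comm chain_sum_meet3 //; first by rewrite [RHS]meetC meetA.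
- by move=> i Iy Ix; apply: Nxy Ix Iy.
- by move=> i Iz Ix; apply: Nxz Ix Iz.
Qed.

(** * The case distinction *)

Lemma Lambda1_sym x y : Lambda1 a (x, y) -> Lambda1 a (y, x).
Proof. by case=> - []; [right|left]. Qed.

Lemma Lambda2_sym i x y : Lambda2 a b i (x, y) -> Lambda2 a b i (y, x).
Proof. by case=> - []; [right|left]. Qed.

Lemma Lambda3_sym i x y : Lambda3 a b i (x, y) -> Lambda3 a b i (y, x).
Proof. by case=> - []; [right|left]. Qed.

(** If a_i <= x, all a_j with j < i are below x, hence i bounds from below the
    indices of the a_j incomparable with x. *)
Lemma A1'_not_ge i x : A1' a x -> ~ a i <= x.
Proof.
move=> [_ Nlb] ax; apply: Nlb; exists i => j /= xj.
rewrite leNgt; apply/negP => ji; move: xj.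
by rewrite /incomp /= /Order.comparable (le_trans (le_a (ltW ji)) ax) orbT.
Qed.

Lemma a_crossing i j x : a i <= x -> ~ a j <= x ->
  exists k, a k <= x /\ ~ a (k + 1)%R <= x.
Proof.
move=> ix jx; have ij : (i < j)%R.
  by rewrite ltNge; apply/negP => ji; apply: jx (le_trans (le_a ji) ix).
have ex : exists n : nat, ~~ (a (i + n%:Z)%R <= x).
  exists `|j - i|%N; have <- : j = (i + `|j - i|%N%:Z)%R by lia.
  exact/negP.
case: (ex_minnP ex) => - [|n] nx minx; first by rewrite GRing.addr0 ix in nx.
exists (i + n%:Z)%R; split.
  by apply/negPn/negP => /minx; rewrite ltnn.
by apply/negP; rewrite -GRing.addrA -PoszD addn1.
Qed.

(** If no a_i is below x, then x is incomparable with all a_k for k small, which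
    puts x in A1'.  Otherwise consecutive a_k, a_{k+1} are found such that only
    the first is below x; the position of b_k tells the last two cases apart,
    since x cannot be comparable with the first endpoint that is not below it
    without being in [a_k, b_k] or in [b_k, a_{k+1}], both included in C. *)
Lemma not_comparables_cases x : ~ C x ->
  [\/ A1' a x, exists i, b (i - 1)%R < x /\ incomp (a i) x
    | exists i, a i < x /\ incomp (b i) x].
Proof.
move=> NCx.
have [j jx] : exists j, ~ (a j <= x).
  apply: contrapT => N; apply: NCx => c [i Ec]; apply/orP; right.
  have ax k : a k <= x by apply: contrapT => ?; apply: N; exists k.
  by case: Ec => ->; rewrite ?(le_trans (le_ba i)).
case: (pselect (exists i, a i <= x)) => [[i ix]|Na]; last first.
  constructor 1.
  have [m xm] : exists m, ~~ (x <= a m).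
    apply: contrapT => N; apply: NCx; apply: below_comparables => m.
    by apply: contrapT => /negP xm; apply: N; exists m.
  have inc k : (k <= m)%R -> incomp (a k) x.
    move=> km; rewrite /incomp /= /Order.comparable negb_or; apply/andP; split.
      by apply: contra xm => /le_trans; apply; apply: le_a.
    by apply/negP => kx; apply: Na; exists k.
  split; first by exists m; apply: inc.
  move=> [l lP]; have := lP _ (inc (Num.min m (l - 1))%R _).
  by rewrite le_min ge_min lexx => /(_ isT); lia.
have [k [kx /negP Nkx]] := a_crossing ix jx.
case: (boolP (b k <= x)) => [bx|Nbx].
  have Nxa : ~~ (x <= a (k + 1)%R).
    apply/negP => xa; apply: NCx; apply: (@gap_comparables (k + 1)).
    by rewrite GRing.addrK /itvcc /= bx.
  constructor 2; exists (k + 1)%R; rewrite GRing.addrK; split.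
    by rewrite lt_neqAle bx andbT; apply: contraNneq Nxa => <-.
  by rewrite /incomp /= /Order.comparable negb_or Nxa.
have Nxb : ~~ (x <= b k).
  apply/negP => xb; apply: NCx; apply: (@itv_comparables k).
  by rewrite /itvcc /= kx.
constructor 3; exists k; split.
  by rewrite lt_neqAle kx andbT; apply: contraNneq Nxb => <-.
by rewrite /incomp /= /Order.comparable negb_or Nxb.
Qed.

(** The endpoint c is the last one below x: b_{i-1} in the case of Lambda_2^i
    and a_i in that of Lambda_3^i. *)
Lemma not_comparables_sep x : ~ C x -> x != \top -> ~ A1' a x ->
  exists c, [/\ endpoint c, c <= x & forall y, c <= y -> y != \top ->
    exists i, Lambda2 a b i (x, y) \/ Lambda3 a b i (x, y)].
Proof.
rewrite -ltx1 => NCx xt NA1.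
case: (not_comparables_cases NCx) => // - [i [cx xi]].
- exists (b (i - 1)%R); split; [exact: endpoint_b|exact: ltW|].
  move=> y cy; rewrite -ltx1 => yt; exists i; left; left.
  split; last exact/andP.
  by split=> //; apply/andP.
- exists (a i); split; [exact: endpoint_a|exact: ltW|].
  move=> y cy; rewrite -ltx1 => yt; exists i; right; left.
  split; last exact/andP.
  by split=> //; apply/andP.
Qed.

Hypothesis Lc : complete_lattice L.

Local Notation p := (interior C).
Local Notation T := (interior_ext p S).

Lemma interior_comparablesP : is_interior C p.
Proof. by apply: interiorP Lc _; apply: comparables_sup. Qed.

(** As p x is comparable with c and c is not below x, p x lies below c; hence
    it is the largest element of C below both x and c. *)
Lemma interior_endpoint c x :
  endpoint c -> ~ c <= x -> C (x `&` c) -> p x = x `&` c.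
Proof.
move=> Ec Ncx Cxc; rewrite -(interior_meet interior_comparablesP Cxc).
apply/esym/meet_idPl.
case/orP: (interior_in interior_comparablesP x _ Ec) => // cp.
by case: Ncx; apply: le_trans cp (interior_le interior_comparablesP x).
Qed.

Lemma ordinal_sum_comm x y : T x y = T y x.
Proof. exact/interior_ext_comm/chain_sum_comm. Qed.

Lemma ordinal_sum_square i x y : square a b i (x, y) -> T x y = Ti i x y.
Proof.
move=> [/= Ix Iy]; case: (eqVneq x \top) => [xt|xt].
  have bx : b i = x by apply/le_anti; rewrite {1}xt lex1; case/andP: Ix.
  by rewrite /interior_ext xt eqxx -xt -bx Ti_b.
case: (eqVneq y \top) => [yt|yt].
  have yb : b i = y by apply/le_anti; rewrite {1}yt lex1; case/andP: Iy.
  by rewrite ordinal_sum_comm /interior_ext yt eqxx -yt -yb Ti_comm // Ti_b.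
rewrite interior_ext_neq1 // !(interior_id interior_comparablesP);
  rewrite ?(@chain_sumE i) //.
- exact: itv_comparables Iy.
- exact: itv_comparables Ix.
Qed.

Lemma itv_meet_b i x : a i <= x -> I i (x `&` b i).
Proof. by move=> ax; rewrite /itvcc /= lexI ax le_ab leIr. Qed.

(** Here p x is the meet of x and b_i, in [a_i, b_i].  Either p y is the meet of
    y and b_i, or b_i <= p y, and then b_i separates p x from p y while the meet
    of y and b_i is the neutral element b_i. *)
Lemma ordinal_sum_Lambda3 i x y : Lambda3 a b i (x, y) ->
  T x y = Ti i (x `&` b i) (y `&` b i).
Proof.
(* Both sides are symmetric in x and y: the first half of Lambda3 suffices. *)
wlog : x y / ((itvoo (a i) \top `&` incomp (b i)) `*` itvco (a i) \top) (x, y).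
  move=> W; case=> H; first by apply: W => //; left.
  case: (H) => /= /andP[ax _] [/andP[/ltW ay _] _].
  rewrite ordinal_sum_comm (Ti_comm (itv_meet_b ax) (itv_meet_b ay)).
  by apply: W; [case: H|left; case: H].
move=> [[/andP[/= ax xt] xb] /andP[/= ay yt]] _.
have Ix := itv_meet_b (ltW ax); have Iy := itv_meet_b ay.
have px : p x = x `&` b i.
  apply: interior_endpoint (endpoint_b i) _ (itv_comparables Ix) => bx.
  by move: xb; rewrite /incomp /= /Order.comparable bx orbT.
rewrite interior_ext_neq1 ?lt_eqF // px.
have py := interior_meet interior_comparablesP (itv_comparables Iy).
case/orP: (interior_in interior_comparablesP y _ (endpoint_b i)) => pb.
  by rewrite -py (meet_idPl pb) (chain_sumE (i := i)) // -(meet_idPl pb) py.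
rewrite (chain_sum_sep (endpoint_b i)) ?leIr //.
by rewrite -py (meet_idPr pb) Ti_comm // Ti_b.
Qed.

(** Here p x is the meet of x and a_i, in the gap between b_{i-1} and a_i.
    Either p y is in that gap too, or a_i separates p x from p y. *)
Lemma ordinal_sum_Lambda2 i x y : Lambda2 a b i (x, y) ->
  T x y = x `&` y `&` a i.
Proof.
wlog : x y / ((itvoo (b (i - 1)%R) \top `&` incomp (a i))
              `*` itvco (b (i - 1)%R) \top) (x, y).
  move=> W; case=> H; first by apply: W => //; left.
  by rewrite ordinal_sum_comm (meetC x); apply: W; [case: H|left; case: H].
move=> [[/andP[/= bx xt] xa] /andP[/= bY yt]] _.
have G z : b (i - 1)%R <= z -> itvcc (b (i - 1)%R) (a i) (z `&` a i).
  by move=> bz; rewrite /itvcc /= lexI bz le_bpred leIr.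
have Gx := G _ (ltW bx); have Gy := G _ bY.
have px : p x = x `&` a i.
  apply: interior_endpoint (endpoint_a i) _ (gap_comparables Gx) => ax.
  by move: xa; rewrite /incomp /= /Order.comparable ax orbT.
rewrite interior_ext_neq1 ?lt_eqF // px.
have py := interior_meet interior_comparablesP (gap_comparables Gy).
rewrite -meetA -py.
case/orP: (interior_in interior_comparablesP y _ (endpoint_a i)) => pa.
  have pyE : p y = y `&` a i by rewrite -py; apply/esym/meet_idPl.
  by rewrite (meet_idPl pa) pyE (chain_sum_gap Gx Gy) -meetA (meetC (a i))
    -meetA meetxx.
by rewrite (chain_sum_sep (endpoint_a i)) ?leIr // (meet_idPr pa).
Qed.

(** Here p x is the meet of x with the infimum of the a_i.  It lies in no
    interval [a_i, b_i], as no a_i is below x, so S is the meet at (p x, p y). *)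
Lemma ordinal_sum_Lambda1 x y : Lambda1 a (x, y) ->
  T x y = x `&` y `&` infimum \bot (range a).
Proof.
have [inf_lb inf_glb] : infimums (range a) (infimum \bot (range a)).
  by apply: infimumsP => //; exists (a 0%R), 0%R.
set m := infimum _ _ in inf_lb inf_glb *.
wlog : x y / (A1' a `*` itvco \bot \top) (x, y).
  move=> W; case=> H; first by apply: W => //; left.
  by rewrite ordinal_sum_comm (meetC x); apply: W; [case: H|left; case: H].
move=> [/= A1x /andP[_ yt]] _.
have xt : x != \top.
  by apply: contra_notN (@A1'_not_ge 0%R _ A1x) => /eqP ->; exact: lex1.
have Cm z : C (z `&` m).
  apply: below_comparables => i.
  by apply: le_trans (leIr _ _) (inf_lb _ _); exists i.
have pm : p x = x `&` m.
  rewrite -(interior_meet interior_comparablesP (Cm x)).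
  apply/esym/meet_idPl/inf_glb.
  move=> _ [i _ <-].
  case/orP: (interior_in interior_comparablesP x _ (endpoint_a i)) => // ap.
  case: (A1'_not_ge (i := i) A1x).
  exact: le_trans ap (interior_le interior_comparablesP x).
rewrite interior_ext_neq1 ?(lt_eqF yt) // pm chain_sum_meet; last first.
  move=> i /andP[/= ax _] _; apply: (A1'_not_ge A1x (i := i)).
  exact: le_trans ax (leIl _ _).
by rewrite -!meetA ![m `&` _]meetC (interior_meet interior_comparablesP (Cm y)).
Qed.

(** Let c be the last endpoint below x; y is not above c, as the pair would
    otherwise be in some Lambda set.  If y is in C, then y <= c <= p x.  If not,
    the last endpoint c' below y is likewise not below x, which contradicts that
    c and c' are comparable. *)
Lemma ordinal_sum_meet_not_comparables x y : ~ C x -> x != \top -> y != \top ->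
  (forall i, ~ Lambda3 a b i (x, y)) -> (forall i, ~ Lambda2 a b i (x, y)) ->
  ~ Lambda1 a (x, y) -> T x y = x `&` y.
Proof.
move=> NCx xt yt N3 N2 N1; rewrite interior_ext_neq1 //.
have NA1x : ~ A1' a x.
  by move=> A1x; apply: N1; left; split=> //; apply/andP; rewrite /= le0x ltx1.
have NA1y : ~ A1' a y.
  by move=> A1y; apply: N1; right; split=> //; apply/andP; rewrite /= le0x ltx1.
have [c [Ec cx Lc3]] := not_comparables_sep NCx xt NA1x.
have Ncy : ~ c <= y.
  by move=> cy; have [i [/N2|/N3]] := Lc3 _ cy yt.
case: (pselect (C y)) => [Cy|NCy].
  have yc : y <= c by case/orP: (Cy _ Ec) => // /Ncy.
  have cp := interior_max interior_comparablesP (endpoint_comparables Ec) cx.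
  rewrite (interior_id interior_comparablesP Cy) (chain_sum_sepr Ec) //.
  by apply/esym/meet_idPr; apply: le_trans yc cx.
have [c' [Ec' cy Lc']] := not_comparables_sep NCy yt NA1y.
case: (endpoint_total Ec Ec') => cc.
  by case: Ncy; apply: le_trans cc cy.
have [i [/Lambda2_sym/N2|/Lambda3_sym/N3]] // := Lc' _ (le_trans cc cx) xt.
Qed.

Lemma ordinal_sum_meet x y :
  (forall i, ~ square a b i (x, y)) ->
  (forall i, ~ Lambda3 a b i (x, y)) -> (forall i, ~ Lambda2 a b i (x, y)) ->
  ~ Lambda1 a (x, y) -> T x y = x `&` y.
Proof.
move=> N4 N3 N2 N1.
case: (eqVneq x \top) => [->|xt]; first by rewrite /interior_ext eqxx meet1x.
case: (eqVneq y \top) => [->|yt].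
  by rewrite ordinal_sum_comm /interior_ext eqxx meetx1.
case: (pselect (C x)) => [Cx|NCx]; last exact: ordinal_sum_meet_not_comparables.
case: (pselect (C y)) => [Cy|NCy]; last first.
  rewrite ordinal_sum_comm meetC.
  apply: ordinal_sum_meet_not_comparables => // [i|i|].
  - by move/Lambda3_sym/N3.
  - by move/Lambda2_sym/N2.
  - by move/Lambda1_sym/N1.
rewrite interior_ext_neq1 // !(interior_id interior_comparablesP) //.
by apply: chain_sum_meet => i Ix Iy; apply: (N4 i).
Qed.

Lemma ordinal_sum_correct : is_ordinal_sum a b Ti T.
Proof.
split; [exact: ordinal_sum_square|exact: ordinal_sum_Lambda3
  |exact: ordinal_sum_Lambda2|exact: ordinal_sum_Lambda1|].
move=> x y N4 N3 N2 N1.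
by apply: ordinal_sum_meet => // i H; [apply: N4|apply: N3|apply: N2]; exists i.
Qed.

Lemma ordinal_sum_is_tnorm : is_tnorm T.
Proof.
apply: (interior_ext_tnorm interior_comparablesP).
- exact: chain_sum_in.
- exact: chain_sum_comm.
- exact: chain_sum_le.
- exact: chain_sum_mono.
- exact: chain_sum_assoc.
Qed.

End Chain.

Lemma ordinal_sum_unique (d : Order.disp_t) (L : tbLatticeType d)
    (a b : int -> L) (Ti : int -> L -> L -> L) (T T' : L -> L -> L) :
  is_ordinal_sum a b Ti T -> is_ordinal_sum a b Ti T' -> T = T'.
Proof.
move=> [T4 T3 T2 T1 T0] [T4' T3' T2' T1' T0'].
apply: funext => x; apply: funext => y.
case: (pselect (exists i, square a b i (x, y))) => [[i H]|N4].
  by rewrite (T4 _ _ _ H) (T4' _ _ _ H).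
case: (pselect (exists i, Lambda3 a b i (x, y))) => [[i H]|N3].
  by rewrite (T3 _ _ _ H) (T3' _ _ _ H).
case: (pselect (exists i, Lambda2 a b i (x, y))) => [[i H]|N2].
  by rewrite (T2 _ _ _ H) (T2' _ _ _ H).
case: (pselect (Lambda1 a (x, y))) => [H|N1].
  by rewrite (T1 _ _ H) (T1' _ _ H).
by rewrite T0 // T0'.
Qed.

Theorem theorem3p6 (d : Order.disp_t) (L : tbLatticeType d)
    (a b : int -> L) (Ti : int -> L -> L -> L) :
  complete_lattice L ->
  (forall i : int, (a i <= b i)%O) ->
  (forall i : int, (b i <= a (i + 1)%R)%O) ->
  (forall i : int, is_tnorm_on (a i) (b i) (Ti i)) ->
  (exists! T : L -> L -> L, is_ordinal_sum a b Ti T) /\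
  (forall T : L -> L -> L, is_ordinal_sum a b Ti T -> is_tnorm T).
Proof.
move=> Lc le_ab le_ba Ti_tnorm.
have sumT := ordinal_sum_correct le_ab le_ba Ti_tnorm Lc.
have tnT := ordinal_sum_is_tnorm le_ab le_ba Ti_tnorm Lc.
split.
  by eexists; split; [exact: sumT|move=> T'; apply: ordinal_sum_unique].
by move=> T /(ordinal_sum_unique sumT) <-.
Qed.
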